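(* Let $\mathcal{C}_1=\{x_0',x_1',\dots,x_k'\}$ be the primary chain. Then $x_0'=x_0$, $x_k'=x_n$, and for all $0\le i\le k$, $$x_i'(t)\rightarrow \frac{|x_n-x_0|}{k}\,i\qquad\text{as } t\rightarrow\infty .$$
   Context: Model. $X=\{x_0,x_1,\dots,x_n\}$ is a finite set of robots on the real line; $x(t)$ is the position of robot $x$ at the discrete time $t=0,1,2,\dots$. Exactly two robots, $x_0$ and $x_n$, are faulty and never move: $x_0(t)=0$ and $x_n(t)=x_n>0$ for all $t$ (the same symbol denotes a robot and its position). $V>0$ is the visibility radius. $N(x(t))$ is the set of robots $y$ with $|x(t)-y(t)|\le V$ (so $x$ itself belongs to it); $l(x(t))$ and $r(x(t))$ denote the leftmost and the rightmost robot in $N(x(t))$. All robots act synchronously: every non-faulty robot $x$ satisfies $x(t+1)=\frac{l(x(t))+r(x(t))}{2}$ for all $t\ge 0$. Non-faulty robots that occupy the same position behave identically and are considered as a single robot from then on (they merge). Size-stable time. A time $t_0$ is size-stable if, for all $t\ge t_0$: (i) there are no inclusions (if $y\notin N(x(t))$ then $y\notin N(x(t+1))$), no mergings (no two distinct robots occupy the same position) and no crossings (if $x(t)<y(t)$ then $x(t+1)<y(t+1)$); and (ii) either all robots are inside $[x_0,x_n]$, or at most one robot is on each side of $[x_0,x_n]$ and these outsiders stay outside, the one on the left (if any) converging to $x_0$ and the one on the right (if any) converging to $x_n$ as $t\to\infty$. It is assumed throughout that every time $t\ge 0$ is size-stable. Chains. In all notions concerning chains the (at most two) outsiders are disregarded,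 i.e. $X$, $l$ and $r$ refer only to robots in $[x_0,x_n]$ (so $l(x_0(t))=x_0$ and $r(x_n(t))=x_n$). A mutual chain at time $t$ is a configuration $\{x_1'(t),\dots,x_m'(t)\}\subseteq X(t)$ of $m\ge1$ distinct robots such that $l(x_{i+1}'(t))=x_i'(t)$ and $r(x_i'(t))=x_{i+1}'(t)$ for all $1\le i\le m-1$. Its left and right anchors are $l(x_1'(t))$ and $r(x_m'(t))$. The primary chain is the unique configuration of robots $\mathcal{C}_1=\{x_0',x_1',\dots,x_k'\}\subseteq X$ with $x_0'=x_0$, $x_k'=x_n$ that is, at all size-stable times $t>0$, a mutual chain (anchored at $x_0$ and $x_n$). *)

(* Defs.v *)
From mathcomp Require Import all_boot all_order all_algebra.
From mathcomp Require Import all_classical all_reals all_analysis.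

Set Implicit Arguments.
Unset Strict Implicit.
Unset Printing Implicit Defensive.

Import Order.TTheory GRing.Theory Num.Theory.
Import numFieldNormedType.Exports.

Local Open Scope classical_set_scope.
Local Open Scope ring_scope.

(* The robots x_0, ..., x_n are the elements of 'I_n.+1,
   the faulty ones being ord0 and ord_max; [x i t] is the position of robot i
   at time t.  The numbering is not assumed to follow the order of positions. *)

Section Robots.
Variables (R : realType) (n : nat) (V : R) (x : 'I_n.+1 -> nat -> R).
Implicit Types (i j : 'I_n.+1) (t : nat) (A : {set 'I_n.+1}).

Definition visible t i : {set 'I_n.+1} := [set j | `|x i t - x j t| <= V].

Definition inside t i : bool := x ord0 t <= x i t <= x ord_max t.
Definition left_outside t i : bool := x i t < x ord0 t.
Definition right_outside t i : bool := x ord_max t < x i t.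

(* The default value i belongs to A in all uses below (when 0 <= V, and i is
   inside for the versions restricted to insiders), so these are true extrema;
   the extremal robot is unique as long as no two robots share a position. *)
Definition leftmost_in A t i := [arg min_(j < i in A) x j t]%O.
Definition rightmost_in A t i := [arg max_(j > i in A) x j t]%O.

Definition l t i := leftmost_in (visible t i) t i.
Definition r t i := rightmost_in (visible t i) t i.

Definition faulty i : bool := (i == ord0) || (i == ord_max).

Definition faulty_fixed : Prop :=
  (forall t, x ord0 t = 0) /\ (forall t, x ord_max t = x ord_max 0).

Definition synchronous_motion : Prop :=
  forall i t, ~~ faulty i -> x i t.+1 = (x (l t i) t + x (r t i) t) / 2.

Definition no_inclusion t : Prop :=
  forall i j, j \notin visible t i -> j \notin visible t.+1 i.

Definition no_merging t : Prop := forall i j, i != j -> x i t != x j t.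

Definition no_crossing t : Prop :=
  forall i j, x i t < x j t -> x i t.+1 < x j t.+1.

Definition outsiders_converge t : Prop :=
  [/\ forall i j, left_outside t i -> left_outside t j -> i = j,
      forall i j, right_outside t i -> right_outside t j -> i = j,
      forall i, ~~ inside t i -> forall t', (t <= t')%N -> ~~ inside t' i,
      forall i, left_outside t i -> x i @ \oo --> x ord0 t
    & forall i, right_outside t i -> x i @ \oo --> x ord_max t].

Definition size_stable (t0 : nat) : Prop :=
  forall t, (t0 <= t)%N ->
    [/\ no_inclusion t, no_merging t, no_crossing t
      & (forall i, inside t i) \/ outsiders_converge t].

(* Chains disregard the outsiders: [lc] and [rc] are the analogues of [l] and
   [r] among the robots of [x_0, x_n]; the motion itself uses [l] and [r]. *)
Definition lc t i := leftmost_in [set j in visible t i | inside t j] t i.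
Definition rc t i := rightmost_in [set j in visible t i | inside t j] t i.

(* A chain of m >= 1 robots is given as c : 'I_k.+1 -> 'I_n.+1 with m = k.+1. *)
Definition mutual_chain k (c : 'I_k.+1 -> 'I_n.+1) t : Prop :=
  [/\ injective c,
      forall a, inside t (c a)
    & forall a b : 'I_k.+1, b = a.+1 :> nat ->
        lc t (c b) = c a /\ rc t (c a) = c b].

Definition left_anchor k (c : 'I_k.+1 -> 'I_n.+1) t := lc t (c ord0).
Definition right_anchor k (c : 'I_k.+1 -> 'I_n.+1) t := rc t (c ord_max).

(* Uniqueness is not part of the definition; it is [primary_chain_unique]. *)
Definition primary_chain k (c : 'I_k.+1 -> 'I_n.+1) : Prop :=
  [/\ c ord0 = ord0, c ord_max = ord_max
    & forall t, (0 < t)%N -> size_stable t ->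
        [/\ mutual_chain c t, left_anchor c t = ord0
          & right_anchor c t = ord_max]].

Lemma primary_chain_unique k k' (c : 'I_k.+1 -> 'I_n.+1)
    (c' : 'I_k'.+1 -> 'I_n.+1) :
  (forall t, size_stable t) -> primary_chain c -> primary_chain c' ->
  k = k' /\ forall (a : 'I_k.+1) (b : 'I_k'.+1), a = b :> nat -> c a = c' b.
Proof.
move=> st [c0 cM /(_ 1%N isT (st _)) [[ci _ cS] _ _]].
move=> [c'0 c'M /(_ 1%N isT (st _)) [[c'i _ c'S] _ _]].
have E (m : nat) (ltm : (m < k.+1)%N) (ltm' : (m < k'.+1)%N) :
    c (Ordinal ltm) = c' (Ordinal ltm').
  elim: m ltm ltm' => [|m IH] ltm ltm'.
    transitivity (ord0 : 'I_n.+1); [rewrite -c0 | rewrite -c'0];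
      by congr (_ _); apply: val_inj.
  have [_ <-] := cS (Ordinal (ltnW ltm)) (Ordinal ltm) erefl.
  have [_ <-] := c'S (Ordinal (ltnW ltm')) (Ordinal ltm') erefl.
  by rewrite (IH (ltnW ltm) (ltnW ltm')).
split; last first.
  by case=> a lta [b ltb] /= eab; move: ltb; rewrite -eab => ltb; exact: E.
case: (ltngtP k k') => // ltk.
- have lk : (k < k'.+1)%N by exact: ltnW.
  have := E k (ltnSn k) lk; rewrite (_ : Ordinal (ltnSn k) = ord_max);
    last exact: val_inj.
  by rewrite cM -c'M => /c'i /(congr1 val) /= ek; rewrite ek ltnn in ltk.
- have lk : (k' < k.+1)%N by exact: ltnW.
  have := E k' lk (ltnSn k'); rewrite (_ : Ordinal (ltnSn k') = ord_max);
    last exact: val_inj.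
  by rewrite c'M -cM => /ci /(congr1 val) /= ek; rewrite -ek ltnn in ltk.
Qed.

End Robots.

(* Main.v *)
Require Import Defs.
From mathcomp Require Import all_boot all_order all_algebra.
From mathcomp Require Import all_classical all_reals all_analysis.
From mathcomp Require Import ring lra zify.

Import Order.TTheory GRing.Theory Num.Theory.
Import numFieldNormedType.Exports.

Local Open Scope classical_set_scope.
Local Open Scope ring_scope.

(** An outsider that replaces a chain neighbour of a chain robot can only
    replace an end of the chain, and it converges to that end.  Hence the
    displacements z_a of the chain robots from the equidistant positions satisfy
    z_a(t+1) = (z_(a-1)(t) + z_(a+1)(t)) / 2 + o(1) with z_0 = z_k = 0.  The
    weight w_a = a (k - a) + 1 satisfies (w_(a-1) + w_(a+1)) / 2 = w_a - 1, so
    averaging is a strict contraction for the norm max_a |z_a| / w_a. *)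

Section PerturbedAveraging.
Set Implicit Arguments.
Unset Strict Implicit.
Variables (R : realType) (k : nat).

Let w (a : nat) : R := a%:R * (k%:R - a%:R) + 1.
Let K : R := k%:R ^+ 2 + 1.

Let w_ge1 a : (a <= k)%N -> 1 <= w a.
Proof.
by move=> ak; rewrite lerDr mulr_ge0 ?ler0n// subr_ge0 ler_nat.
Qed.

Let w_leK a : (a <= k)%N -> w a <= K.
Proof.
move=> ak; rewrite lerD2r expr2 ler_pM ?ler0n ?subr_ge0 ?ler_nat//.
by rewrite gerBl ler0n.
Qed.

Let K_ge1 : 1 <= K. Proof. by rewrite lerDr sqr_ge0. Qed.

(** The two neighbours contribute at most [W * (w a - 1)]. Since [w a <= K], the 1 gained is worth
    at least the fraction [K^-1] of [w a], and since [1 <= w a], the error [e] is absorbed into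
    [e * w a]. At the two ends [v] vanishes. *)
Let averaging_step (W e : R) (u v : nat -> R) :
  0 <= W -> 0 <= e -> v 0%N = 0 -> v k = 0 ->
  (forall a, (0 < a < k)%N -> `|v a - (u a.-1 + u a.+1) / 2| <= e) ->
  (forall a, (a <= k)%N -> `|u a| <= W * w a) ->
  forall a, (a <= k)%N -> `|v a| <= ((1 - K^-1) * W + e) * w a.
Proof.
move=> W0 e0 v0 vk step uW a ak.
have K0 : 0 < K by apply: lt_le_trans K_ge1.
have rho0 : 0 <= 1 - K^-1 by rewrite subr_ge0 invf_le1.
have w1 := w_ge1 ak.
have rhs0 : 0 <= ((1 - K^-1) * W + e) * w a.
  apply: mulr_ge0; last exact: le_trans w1.
  by rewrite addr_ge0// mulr_ge0.
have [a0|a0] := posnP a; first by rewrite {1}a0 v0 normr0.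
have [eak|nak] := eqVneq a k; first by rewrite {1}eak vk normr0.
have ak' : (0 < a < k)%N by lia.
have := step a ak'; have := uW a.-1 ltac:(lia); have := uW a.+1 ltac:(lia).
have wE : w a.-1 + w a.+1 = 2 * (w a - 1).
  have -> : a = a.-1.+1 by lia.
  by rewrite /w -!natr1 /=; ring.
have wK : W * (K^-1 * w a) <= W * 1.
  by rewrite ler_wpM2l// mulrC ler_pdivrMr// mul1r w_leK.
have we : e * 1 <= e * w a by rewrite ler_wpM2l.
have WwE : W * w a.-1 + W * w a.+1 = 2 * (W * w a - W).
  by rewrite -mulrDr wE; ring.
rewrite !ler_norml => /andP[? ?] /andP[? ?] /andP[? ?].
have -> : ((1 - K^-1) * W + e) * w a = W * w a - W * (K^-1 * w a) + e * w a.
  by ring.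
by apply/andP; split; lra.
Qed.

(** Once the error stays below a small [d], iterating the contraction makes the bound on the
    weighted norm decay geometrically to the level [K * d]. *)
Lemma perturbed_averaging_cvg0 (z : nat -> nat -> R) :
  (forall t, z 0%N t = 0) -> (forall t, z k t = 0) ->
  (forall e : R, 0 < e -> \forall t \near \oo, forall a, (0 < a < k)%N ->
     `|z a t.+1 - (z a.-1 t + z a.+1 t) / 2| <= e) ->
  forall a, (a <= k)%N -> z a @ \oo --> (0 : R).
Proof.
move=> z0 zk step a ak.
have K0 : 0 < K by apply: lt_le_trans K_ge1.
have rho0 : 0 <= 1 - K^-1 by rewrite subr_ge0 invf_le1.
have rho1 : 1 - K^-1 < 1 by rewrite gtrBl invr_gt0.
apply/cvgr0Pnorm_le => e e0.
(* The map sending [W] to [(1 - K^-1) * W + d] has fixed point [K * d]. As weights are at most [K],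
   this level contributes at most [K * d * K = e / 2], which leaves [e / 2] for the geometric
   term. *)
pose d := e / (2 * K ^+ 2).
have d0 : 0 < d by rewrite divr_gt0// mulr_gt0// exprn_gt0.
have [T _ HT] := step d d0.
(* Any common bound of the [z b T] can start the iteration because the weights are at least 1; the
   sum avoids a maximum. *)
pose W0 := \sum_(b < k.+1) `|z b T|.
have W0_ge0 : 0 <= W0 by apply: sumr_ge0.
have Kd : 0 <= K * d by rewrite mulr_ge0// ltW.
have bound s : forall b, (b <= k)%N ->
    `|z b (T + s)%N| <= ((1 - K^-1) ^+ s * W0 + K * d) * w b.
  elim: s => [|s IH] b bk.
    rewrite addn0 expr0 mul1r.
    have zW : `|z b T| <= W0.
      rewrite /W0 (bigD1 (Ordinal (bk : (b < k.+1)%N)))//=.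
      by rewrite lerDl sumr_ge0.
    rewrite (le_trans zW)// (le_trans (_ : _ <= W0 + K * d)) ?lerDl//.
    by rewrite ler_peMr ?addr_ge0// w_ge1.
  have -> : (1 - K^-1) ^+ s.+1 * W0 + K * d =
      (1 - K^-1) * ((1 - K^-1) ^+ s * W0 + K * d) + d.
    by rewrite exprS; field; rewrite gt_eqF.
  rewrite addnS.
  apply: (averaging_step (u := z ^~ (T + s)%N) (v := z ^~ (T + s).+1)) => //.
  - by rewrite addr_ge0// mulr_ge0// exprn_ge0.
  - exact: ltW.
  - by apply: HT; rewrite /= leq_addr.
have /cvgr0Pnorm_le geo :
    (fun s => (1 - K^-1) ^+ s * (W0 * K)) @ \oo --> (0 : R).
  rewrite -[X in _ --> X](mul0r (W0 * K)); apply: cvgMl.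
  by apply: cvg_expr; rewrite ger0_norm.
have [S _ HS] := geo (e / 2) ltac:(by rewrite divr_gt0).
exists (T + S)%N => // t /= TSt.
have -> : t = (T + (t - T))%N by lia.
apply: le_trans (bound _ _ ak) _.
have := HS (t - T)%N ltac:(rewrite /=; lia).
rewrite ger0_norm ?mulr_ge0 ?exprn_ge0 ?(ltW K0)// => geoS.
have WK : ((1 - K^-1) ^+ (t - T) * W0 + K * d) * w a <=
    ((1 - K^-1) ^+ (t - T) * W0 + K * d) * K.
  by rewrite ler_wpM2l ?w_leK// addr_ge0// mulr_ge0// exprn_ge0.
apply: le_trans WK _; rewrite mulrDl.
have -> : K * d * K = e / 2 by rewrite /d; field; rewrite gt_eqF.
by move: geoS; rewrite mulrA; lra.
Qed.

End PerturbedAveraging.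

Section Neighbours.
Set Implicit Arguments.
Unset Strict Implicit.
Variables (R : realType) (n : nat) (V : R) (x : 'I_n.+1 -> nat -> R).
Hypothesis V_ge0 : 0 <= V.

Lemma visible_refl t i : i \in visible V x t i.
Proof. by rewrite inE subrr normr0. Qed.

(** If the leftmost visible robot is an outsider, it lies to the left of [ord0], being no further
    right than [i]. Then [ord0] lies between it and [i], hence is visible and is leftmost among the
    visible insiders. Comparing positions instead of robots makes ties in the arg min harmless. *)
Lemma l_position t i : x ord0 t <= x ord_max t -> inside x t i ->
  x (l V x t i) t = x (lc V x t i) t \/
  left_outside x t (l V x t i) /\ x (lc V x t i) t = x ord0 t.
Proof.
move=> le0M ii.
rewrite /l /lc /leftmost_in.
case: arg_minP => [|p pv pmin]; first exact: visible_refl.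
case: arg_minP => [|q]; first by rewrite inE visible_refl.
rewrite inE => /andP[qv qi] qmin.
have [pi|] := boolP (inside x t p).
  by left; apply/le_anti; rewrite pmin//= qmin// inE pv.
have pxi := pmin _ (visible_refl t i).
move: (ii) (qi) => /andP[? ?] /andP[? ?].
rewrite /inside negb_and -!ltNge => /orP[p0|]; last by lra.
right; split => //; apply/le_anti/andP; split; last by [].
apply: qmin; rewrite inE /inside lexx le0M !inE !andbT.
by move: pv; rewrite inE !ler_norml => /andP[? ?]; apply/andP; split; lra.
Qed.

Lemma r_position t i : x ord0 t <= x ord_max t -> inside x t i ->
  x (r V x t i) t = x (rc V x t i) t \/
  right_outside x t (r V x t i) /\ x (rc V x t i) t = x ord_max t.
Proof.
move=> le0M ii.
rewrite /r /rc /rightmost_in.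
case: arg_maxP => [|p pv pmax]; first exact: visible_refl.
case: arg_maxP => [|q]; first by rewrite inE visible_refl.
rewrite inE => /andP[qv qi] qmax.
have [pi|] := boolP (inside x t p).
  left; apply/le_anti/andP; split; last exact: pmax.
  by apply: qmax; rewrite inE pv.
have pxi : x i t <= x p t := pmax _ (visible_refl t i).
move: (ii) (qi) => /andP[? ?] /andP[? ?].
rewrite /inside negb_and -!ltNge => /orP[|pM]; first by lra.
right; split => //; apply/le_anti/andP; split; first by [].
apply: qmax; rewrite inE /inside lexx le0M !inE !andbT.
by move: pv; rewrite inE !ler_norml => /andP[? ?]; apply/andP; split; lra.
Qed.

Hypothesis xfix : faulty_fixed x.
Hypothesis xstable : forall t, size_stable V x t.

(** There are finitely many robots, so one threshold serves them all: a robot that is ever on the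
    left converges to [ord0] by stability at that time, and for any other robot the claim is
    vacuous. *)
Lemma left_outsiders_near (e : R) : 0 < e ->
  \forall t \near \oo, forall i, left_outside x t i -> `|x i t - x ord0 t| <= e.
Proof.
move=> e0; apply: filter_forall => i.
have [[s si]|no] := pselect (exists s, left_outside x s i); last first.
  by near=> t => ti; case: no; exists t.
have [_ _ _ [|[_ _ _ cvgl _]]] := @xstable s s (leqnn s).
  by move=> /(_ i) /andP[]; rewrite leNgt => /negP.
have /cvgrPdist_le/(_ _ e0) := cvgl i si.
by apply: filterS => t; rewrite distrC !xfix.1.
Unshelve. all: by end_near. Qed.

Lemma right_outsiders_near (e : R) : 0 < e ->
  \forall t \near \oo, forall i,
    right_outside x t i -> `|x i t - x ord_max t| <= e.
Proof.
move=> e0; apply: filter_forall => i.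
have [[s si]|no] := pselect (exists s, right_outside x s i); last first.
  by near=> t => ti; case: no; exists t.
have [_ _ _ [|[_ _ _ _ cvgr]]] := @xstable s s (leqnn s).
  by move=> /(_ i) /andP[_]; rewrite leNgt => /negP.
have /cvgrPdist_le/(_ _ e0) := cvgr i si.
by apply: filterS => t; rewrite distrC xfix.2 (xfix.2 t).
Unshelve. all: by end_near. Qed.

End Neighbours.

Theorem theorem15 (R : realType) (n : nat) (V : R) (x : 'I_n.+1 -> nat -> R)
    (V_gt0 : 0 < V)
    (xfix : faulty_fixed x)
    (xn_gt0 : 0 < x ord_max 0%N)
    (xmove : synchronous_motion V x)
    (xstable : forall t : nat, size_stable V x t)
    (k : nat) (c : 'I_k.+1 -> 'I_n.+1)
    (cprim : primary_chain V x c) :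
  [/\ c ord0 = ord0, c ord_max = ord_max
    & forall i : 'I_k.+1,
        x (c i) @ \oo -->
          `|x ord_max 0%N - x ord0 0%N| / k%:R * (i : nat)%:R].
Proof.
have [c0 cM chain] := cprim; split=> // i.
have [x0 xM] := xfix.
(* A one-robot chain would identify the two faulty robots, against [xn_gt0]. *)
have k_gt0 : (0 < k)%N.
  rewrite lt0n; apply/negP => /eqP k0; move: xn_gt0.
  rewrite -cM -(x0 0%N) -c0 (_ : ord_max = ord0) ?ltxx//.
  by apply: val_inj; rewrite /= k0.
have kn0 : k%:R != 0 :> R by rewrite pnatr_eq0 -lt0n.
rewrite x0 subr0 gtr0_norm//; set L := x ord_max 0%N.
pose z (a t : nat) := x (c (inord a)) t - L / k%:R * a%:R.
have zE : x (c i) = fun t => z i t + L / k%:R * i%:R.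
  by apply/funext => t; rewrite /z inord_val subrK.
rewrite zE -[X in _ --> X]add0r; apply: cvgD; last exact: cvg_cst.
have inord0 : inord 0 = ord0 :> 'I_k.+1 by apply: val_inj; rewrite /= inordK.
have inordM : inord k = ord_max :> 'I_k.+1 by apply: val_inj; rewrite /= inordK.
apply: (@perturbed_averaging_cvg0 R k) => [t|t|e e0|]; last by rewrite -ltnS.
- by rewrite /z inord0 c0 x0 mulr0 subr0.
- by rewrite /z inordM cM xM divfK// subrr.
(* Time 0 is excluded because the chain is known to be mutual only at positive times. *)
apply: filterS3 (nbhs_infty_gt 0) (left_outsiders_near xfix xstable e0)
  (right_outsiders_near xfix xstable e0) => t t0 lout rout a /andP[a0 ak].
have [[cinj cin cnb] _ _] := chain t t0 (xstable t).
(* By injectivity of the chain, only its ends are faulty, so the motion law applies here. *)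
have nf : ~~ faulty (c (inord a)).
  rewrite /faulty -{1}c0 -cM !(inj_eq cinj) -!val_eqE /= inordK; lia.
have lcE : lc V x t (c (inord a)) = c (inord a.-1).
  by have [|//] := cnb (inord a.-1) (inord a); rewrite !inordK; lia.
have rcE : rc V x t (c (inord a)) = c (inord a.+1).
  by have [|//] := cnb (inord a) (inord a.+1); rewrite !inordK; lia.
have le0M : x ord0 t <= x ord_max t by rewrite x0 xM ltW.
(* When an outsider takes the place of the chain neighbour, that neighbour is at the position of
   [ord0], to which the outsider is already [e]-close. *)
have lnear : `|x (l V x t (c (inord a))) t - x (c (inord a.-1)) t| <= e.
  have [|[]] := l_position (ltW V_gt0) le0M (cin (inord a)); rewrite lcE.
    by move=> ->; rewrite subrr normr0 ltW.
  by move=> lo ->; exact: lout.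
have rnear : `|x (r V x t (c (inord a))) t - x (c (inord a.+1)) t| <= e.
  have [|[]] := r_position (ltW V_gt0) le0M (cin (inord a)); rewrite rcE.
    by move=> ->; rewrite subrr normr0 ltW.
  by move=> ro ->; exact: rout.
rewrite /z xmove//.
(* The equidistant positions are invariant under averaging, so they cancel; what remains is the mean
   of the two neighbour errors, each at most [e]. *)
have linear : L / k%:R * a.-1%:R + L / k%:R * a.+1%:R = 2 * (L / k%:R * a%:R).
  have -> : a = a.-1.+1 by lia.
  by rewrite /= -!natr1; ring.
move: lnear rnear; rewrite !ler_norml => /andP[? ?] /andP[? ?].
by apply/andP; split; lra.
Qed.
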